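(* Let $a,b$ be positive semidefinite symmetric sesquilinear forms on a Hilbert space with the common dense domain $\mathcal{D}$ and respective lower bounds $\alpha,\beta\ge 0$, and such that $a + b$ is closed. Define the form $h$ on $\mathcal{D}\oplus\mathcal{D}$ by $h(x,y) = a(x_1,y_1) + b(x_2,y_1) + b(x_1,y_2) - a(x_2,y_2)$ for $x = (x_1,x_2)$, $y=(y_1,y_2)$ in $\mathcal{D}\oplus\mathcal{D}$. Then $h$ defines a unique selfadjoint operator $H$ with $\mathcal{D}(H) \subseteq \mathcal{D} \oplus \mathcal{D}$ and $h(x,y) = (Hx,y)$ for $x \in \mathcal{D}(H)$, $y \in \mathcal{D}\oplus \mathcal{D}$. Moreover, if any of $\alpha,\beta$ is non-zero then $H$ has a bounded inverse with $\|H^{-1}\| \leq \frac{1}{\sqrt{\alpha^2 + \beta^2}}$.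
   Context: The form $h$ is the form analogue of the block operator matrix $\begin{bmatrix} A & B \\ B & -A\end{bmatrix}$. Lower bound $\alpha$ of $a$ means $a(z,z)\ge \alpha\|z\|^2$ for all $z\in\mathcal{D}$ (similarly $\beta$ for $b$). In the bounded case with $A=a$, $B=b$ positive definite this reduces to the spectral gap $(-\sqrt{\min\sigma(A)^2+\min\sigma(B)^2},\sqrt{\min\sigma(A)^2+\min\sigma(B)^2})$ around zero. *)

(* Defs.v *)
From HB Require Import structures.
From mathcomp Require Import all_boot all_order all_algebra.
From mathcomp Require Import reals complex.
Set Implicit Arguments. Unset Strict Implicit. Unset Printing Implicit Defensive.
Import Order.TTheory GRing.Theory Num.Theory.
Local Open Scope ring_scope.

Section Hilbert.
Variables (R : realType) (V : lmodType R[i]).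

Definition inner_product (ip : V -> V -> R[i]) : Prop :=
  [/\ (forall (c : R[i]) x y z, ip (c *: x + y) z = c * ip x z + ip y z),
      (forall x y, ip x y = conjc (ip y x)),
      (forall x, 0 <= ip x x) &
      (forall x, ip x x = 0 -> x = 0)].

Definition hnorm (ip : V -> V -> R[i]) (x : V) : R := Num.sqrt (complex.Re (ip x x)).

Definition converges_to (ip : V -> V -> R[i]) (u : nat -> V) (x : V) : Prop :=
  forall e : R, 0 < e -> exists N, forall n, (N <= n)%N -> hnorm ip (u n - x) < e.

Definition complete (ip : V -> V -> R[i]) : Prop :=
  forall u : nat -> V,
    (forall e : R, 0 < e -> exists N, forall m n, (N <= m)%N -> (N <= n)%N ->
        hnorm ip (u m - u n) < e) ->
    exists x, converges_to ip u x.

Definition is_hilbert (ip : V -> V -> R[i]) : Prop := inner_product ip /\ complete ip.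

Definition subspace (D : V -> Prop) : Prop :=
  D 0 /\ forall (c : R[i]) x y, D x -> D y -> D (c *: x + y).

Definition dense (ip : V -> V -> R[i]) (D : V -> Prop) : Prop :=
  forall x (e : R), 0 < e -> exists d, D d /\ hnorm ip (x - d) < e.

Definition sesquilinear_on (D : V -> Prop) (a : V -> V -> R[i]) : Prop :=
  (forall (c : R[i]) x x' y, D x -> D x' -> D y ->
      a (c *: x + x') y = c * a x y + a x' y) /\
  (forall (c : R[i]) x y y', D x -> D y -> D y' ->
      a x (c *: y + y') = conjc c * a x y + a x y').

Definition symmetric_on (D : V -> Prop) (a : V -> V -> R[i]) : Prop :=
  forall x y, D x -> D y -> a x y = conjc (a y x).

Definition psd_on (D : V -> Prop) (a : V -> V -> R[i]) : Prop :=
  forall x, D x -> 0 <= a x x.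

Definition lower_bound_on (ip : V -> V -> R[i]) (D : V -> Prop)
    (a : V -> V -> R[i]) (alpha : R) : Prop :=
  forall z, D z -> ((alpha * hnorm ip z ^+ 2)%:C)%C <= a z z.

Definition closed_form (ip : V -> V -> R[i]) (D : V -> Prop)
    (t : V -> V -> R[i]) : Prop :=
  forall (u : nat -> V) (x : V),
    (forall n, D (u n)) -> converges_to ip u x ->
    (forall e : R, 0 < e -> exists N, forall m n, (N <= m)%N -> (N <= n)%N ->
        `|t (u n - u m) (u n - u m)| < (e%:C)%C) ->
    D x /\
    (forall e : R, 0 < e -> exists N, forall n, (N <= n)%N ->
        `|t (u n - x) (u n - x)| < (e%:C)%C).

End Hilbert.

Record operator (W : Type) := Op { op_dom : W -> Prop; op_app : W -> W }.

Section Operators.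
Variables (R : realType) (W : lmodType R[i]).

Definition linear_operator (T : operator W) : Prop :=
  subspace (op_dom T) /\
  forall (c : R[i]) x y, op_dom T x -> op_dom T y ->
    op_app T (c *: x + y) = c *: op_app T x + op_app T y.

Definition adjoint_dom (ip : W -> W -> R[i]) (T : operator W) (y : W) : Prop :=
  exists z, forall x, op_dom T x -> ip (op_app T x) y = ip x z.

Definition selfadjoint (ip : W -> W -> R[i]) (T : operator W) : Prop :=
  [/\ linear_operator T, dense ip (op_dom T),
      (forall y, adjoint_dom ip T y <-> op_dom T y) &
      (forall x y, op_dom T x -> op_dom T y ->
         ip (op_app T x) y = ip x (op_app T y))].

Definition represents (ip : W -> W -> R[i]) (Dh : W -> Prop)
    (h : W -> W -> R[i]) (T : operator W) : Prop :=
  (forall x, op_dom T x -> Dh x) /\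
  (forall x y, op_dom T x -> Dh y -> h x y = ip (op_app T x) y).

Definition same_operator (T T' : operator W) : Prop :=
  (forall x, op_dom T x <-> op_dom T' x) /\
  (forall x, op_dom T x -> op_app T x = op_app T' x).

Definition bounded_inverse_norm_le (ip : W -> W -> R[i]) (T : operator W)
    (c : R) : Prop :=
  exists G : W -> W,
    [/\ (forall y, op_dom T (G y) /\ op_app T (G y) = y),
        (forall x, op_dom T x -> G (op_app T x) = x),
        (forall (k : R[i]) y z, G (k *: y + z) = k *: G y + G z) &
        (forall y, hnorm ip (G y) <= c * hnorm ip y)].

End Operators.

Definition ip_sum (R : realType) (V : lmodType R[i]) (ip : V -> V -> R[i])
    (x y : V * V) : R[i] := ip x.1 y.1 + ip x.2 y.2.

Definition dom_sum (V : Type) (D : V -> Prop) (x : V * V) : Prop := D x.1 /\ D x.2.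

Definition hform (R : realType) (V : lmodType R[i]) (a b : V -> V -> R[i])
    (x y : V * V) : R[i] :=
  a x.1 y.1 + b x.2 y.1 + b x.1 y.2 - a x.2 y.2.

(* Main.v *)
(* Put t = a + b and give D + D the Hilbert space inner product g = ip + t. The
   form h is not semibounded, but it is coercive up to a twist: with
   T x = (x1 + x2, x1 - x2) one has Re h(x, T x) = t(x), and T is symmetric for
   ip. Hence h + i mu is bounded below for g when tested against T x + i mu x,
   and an inf-sup argument shows that h + i mu is solvable for mu = 1 and
   mu = -1, which makes the symmetric operator H attached to h selfadjoint.
   Twisting instead by (alpha x1 + beta x2, beta x1 - alpha x2), a multiple
   sqrt(alpha^2 + beta^2) of an isometry, gives
   (alpha^2 + beta^2) |x|^2 <= Re h(x, twist x), hence the norm of the inverse;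
   its existence is the solvability for mu = 0. *)

Require Import Defs.
From HB Require Import structures.
From mathcomp Require Import all_boot all_order all_algebra.
From mathcomp Require Import reals complex.
From mathcomp Require Import boolp classical_sets.
From mathcomp Require Import ring lra.
Set Implicit Arguments. Unset Strict Implicit. Unset Printing Implicit Defensive.
Import Order.TTheory GRing.Theory Num.Theory.
Local Open Scope ring_scope.

(** * Linear subspaces and membership in them *)

Section Subspace.
Context {R : realType} {V : lmodType R[i]} {D : V -> Prop} (hD : subspace D).

Lemma subspaceD x y : D x -> D y -> D (x + y).
Proof. by move=> Dx Dy; rewrite -[x]scale1r; apply: hD.2. Qed.

Lemma subspaceZ c x : D x -> D (c *: x).
Proof. by move=> Dx; rewrite -[_ *: _]addr0; apply: hD.2 => //; exact: hD.1. Qed.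

Lemma subspaceN x : D x -> D (- x).
Proof. by move=> Dx; rewrite -scaleN1r; apply: subspaceZ. Qed.

End Subspace.

Lemma subspace_sum {R : realType} {V : lmodType R[i]} {D : V -> Prop} :
  subspace D -> subspace (dom_sum D).
Proof.
move=> hD; split; first by split; exact: hD.1.
by move=> c x y [x1 x2] [y1 y2]; split; apply: hD.2.
Qed.

Ltac subsp := solve [repeat match goal with
  | H : ?P |- ?P => exact H
  | H : subspace ?D |- ?D 0 => exact (proj1 H)
  | H : subspace ?D |- ?D (_ + _) => apply (subspaceD H)
  | H : subspace ?D |- ?D (- _) => apply (subspaceN H)
  | H : subspace ?D |- ?D (_ *: _) => apply (subspaceZ H)
  | H : forall n, ?D (?u n) |- ?D (?u _) => apply H
  | H : forall x, ?D x -> ?E x |- ?E _ => apply H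
  | H : forall x, ?D x -> ?E (?S x) |- ?E (?S _) => apply H
  end].

(** * Real part, imaginary part and conjugation *)

Section Complex.
Context {R : realType}.
Implicit Types c z : R[i].
Import complex.

Lemma ReD c z : Re (c + z) = Re c + Re z. Proof. by case: c; case: z. Qed.
Lemma ImD c z : Im (c + z) = Im c + Im z. Proof. by case: c; case: z. Qed.
Lemma ReN z : Re (- z) = - Re z. Proof. by case: z. Qed.
Lemma ImN z : Im (- z) = - Im z. Proof. by case: z. Qed.
Lemma ReM c z : Re (c * z) = Re c * Re z - Im c * Im z.
Proof. by case: c; case: z. Qed.
Lemma ImM c z : Im (c * z) = Re c * Im z + Im c * Re z.
Proof. by case: c; case: z. Qed.
Lemma Re_conj z : Re (conjc z) = Re z. Proof. by case: z. Qed.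
Lemma Im_conj z : Im (conjc z) = - Im z. Proof. by case: z. Qed.

Definition complexD := (ReD, ImD, ReN, ImN, ReM, ImM, Re_conj, Im_conj).

Lemma conjcD c z : conjc (c + z) = conjc c + conjc z.
Proof. exact: rmorphD. Qed.
Lemma conjcN z : conjc (- z) = - conjc z.
Proof. exact: rmorphN. Qed.
Lemma conjcM c z : conjc (c * z) = conjc c * conjc z.
Proof. exact: rmorphM. Qed.

Lemma complex_ext c z : Re c = Re z -> Im c = Im z -> c = z.
Proof. by case: c; case: z => /= ? ? ? ? -> ->. Qed.

End Complex.

(** A symmetric form is real on the diagonal, so for such forms the real part loses nothing and
    lands in an ordered field. *)
Definition qf {R : realType} {V : lmodType R[i]} (f : V -> V -> R[i]) (x : V) : R :=
  complex.Re (f x x).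

(** * Sesquilinear forms on a subspace: polarization and Cauchy-Schwarz *)

Section Form.
Context {R : realType} {V : lmodType R[i]} {D : V -> Prop} (hD : subspace D).
Context {f : V -> V -> R[i]} (hf : sesquilinear_on D f).

Lemma sesqDl x x' y : D x -> D x' -> D y -> f (x + x') y = f x y + f x' y.
Proof. by move=> *; rewrite -{1}[x]scale1r hf.1 // mul1r. Qed.

Lemma sesq0l y : D y -> f 0 y = 0.
Proof. by move=> Dy; rewrite -(subrr 0) -scaleN1r addrC hf.1 ?mulN1r ?addNr //; exact: hD.1. Qed.

Lemma sesqZl c x y : D x -> D y -> f (c *: x) y = c * f x y.
Proof. by move=> *; rewrite -[_ *: _]addr0 hf.1 ?sesq0l ?addr0 //; exact: hD.1. Qed.

Lemma sesqNl x y : D x -> D y -> f (- x) y = - f x y.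
Proof. by move=> *; rewrite -scaleN1r sesqZl // mulN1r. Qed.

Lemma sesqDr x y y' : D x -> D y -> D y' -> f x (y + y') = f x y + f x y'.
Proof. by move=> *; rewrite -{1}[y]scale1r hf.2 // conjc1 mul1r. Qed.

Lemma sesq0r x : D x -> f x 0 = 0.
Proof.
by move=> Dx; rewrite -(subrr 0) -scaleN1r addrC hf.2 ?conjcN ?conjc1 ?mulN1r ?addNr //; exact: hD.1.
Qed.

Lemma sesqZr c x y : D x -> D y -> f x (c *: y) = conjc c * f x y.
Proof. by move=> *; rewrite -[_ *: _]addr0 hf.2 ?sesq0r ?addr0 //; exact: hD.1. Qed.

Lemma sesqNr x y : D x -> D y -> f x (- y) = - f x y.
Proof. by move=> *; rewrite -scaleN1r sesqZr // conjcN conjc1 mulN1r. Qed.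

Context (hs : symmetric_on D f).

Lemma symRe x y : D x -> D y -> complex.Re (f x y) = complex.Re (f y x).
Proof. by move=> Dx Dy; rewrite hs // Re_conj. Qed.

Lemma sym_diag_Im x : D x -> complex.Im (f x x) = 0.
Proof. by move=> Dx; have := congr1 (@complex.Im R) (hs Dx Dx); rewrite Im_conj; lra. Qed.

Lemma qfD x y : D x -> D y -> qf f (x + y) = qf f x + 2 * complex.Re (f x y) + qf f y.
Proof.
move=> Dx Dy; have Dxy := subspaceD hD Dx Dy.
by rewrite /qf sesqDl // !sesqDr // !complexD (symRe Dy Dx); ring.
Qed.

Lemma qfN x : D x -> qf f (- x) = qf f x.
Proof.
move=> Dx; have DNx := subspaceN hD Dx.
by rewrite /qf sesqNl // sesqNr // opprK.
Qed.

Lemma qfB x y : D x -> D y -> qf f (x - y) = qf f x - 2 * complex.Re (f x y) + qf f y.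
Proof.
move=> Dx Dy; have DNy := subspaceN hD Dy.
by rewrite qfD // qfN // sesqNr // !complexD; ring.
Qed.

Lemma qfZ c x : D x -> qf f (c *: x) = (complex.Re c ^+ 2 + complex.Im c ^+ 2) * qf f x.
Proof.
move=> Dx; have Dcx := subspaceZ hD c Dx.
by rewrite /qf sesqZl // sesqZr // !complexD sym_diag_Im //; ring.
Qed.

Lemma qfDZ s x y : D x -> D y ->
  qf f (x + (s%:C)%C *: y) = qf f x + 2 * s * complex.Re (f x y) + s ^+ 2 * qf f y.
Proof.
move=> Dx Dy; have Dsy := subspaceZ hD (s%:C)%C Dy.
by rewrite qfD // qfZ // sesqZr // !complexD /=; ring.
Qed.

Lemma qf_parallelogram x y : D x -> D y ->
  qf f (x + y) + qf f (x - y) = 2 * qf f x + 2 * qf f y.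
Proof. by move=> Dx Dy; rewrite qfD ?qfB //; ring. Qed.

Context (hp : psd_on D f).

Lemma qf_ge0 x : D x -> 0 <= qf f x.
Proof. by move=> Dx; have := hp Dx; rewrite lecE /= => /andP[]. Qed.

(** The quadratic polynomial [s |-> qf f (x + s y)] is nonnegative on the reals. The case
    [qf f y = 0] is separate, because [f] need not be definite. *)
Lemma cauchy_schwarz x y : D x -> D y -> complex.Re (f x y) ^+ 2 <= qf f x * qf f y.
Proof.
move=> Dx Dy; set p := complex.Re (f x y).
have H s : 0 <= qf f x + 2 * s * p + s ^+ 2 * qf f y.
  by rewrite -qfDZ //; apply: qf_ge0; subsp.
have [y0|yn0] := eqVneq (qf f y) 0.
  have [->|pn0] := eqVneq p 0; first by rewrite y0 expr0n mulr0.
  (* The polynomial is affine here and takes the value -1 at this point. *)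
  have := H (- (qf f x + 1) / (2 * p)); rewrite y0.
  have -> : 2 * (- (qf f x + 1) / (2 * p)) * p = - (qf f x + 1) by field.
  by lra.
have y1 : 0 < qf f y by rewrite lt_def yn0 qf_ge0.
(* The minimiser of the polynomial. *)
have := H (- p / qf f y).
have -> : qf f x + 2 * (- p / qf f y) * p + (- p / qf f y) ^+ 2 * qf f y
   = (qf f x * qf f y - p ^+ 2) / qf f y by field.
by rewrite pmulr_lge0 ?invr_gt0 // subr_ge0.
Qed.

(** Replacing [y] by ['i *: y] turns the imaginary part of [f x y] into a real part and keeps
    [qf f y]. *)
Lemma cauchy_schwarz_Im x y : D x -> D y -> complex.Im (f x y) ^+ 2 <= qf f x * qf f y.
Proof.
move=> Dx Dy; have Diy := subspaceZ hD 'i%C Dy.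
have := cauchy_schwarz Dx Diy; rewrite sesqZr // qfZ // !complexD /=.
by rewrite mul0r mulN1r sub0r opprK expr0n expr1n add0r mul1r.
Qed.

Lemma qfD_le x y : D x -> D y -> qf f (x + y) <= 2 * qf f x + 2 * qf f y.
Proof.
by move=> Dx Dy; rewrite -qf_parallelogram // lerDl qf_ge0 //; subsp.
Qed.

End Form.

(** * Two elementary facts about real numbers *)

Lemma invn_small {R : realType} (e : R) : 0 < e ->
  exists N, forall n, (N <= n)%N -> n.+1%:R^-1 < e.
Proof.
move=> e0; exists (Num.bound e^-1) => n Nn.
rewrite invf_plt ?posrE ?ltr0n //.
apply: lt_le_trans (archi_boundP _) _; first by rewrite invr_ge0 ltW.
by rewrite ler_nat (leq_trans Nn).
Qed.

(** At [- d / (k + 1)], close to the minimiser [- d / k] but defined also for [k = 0], the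
    polynomial is a negative multiple of [d ^+ 2]. This extracts the Euler equation of a
    minimisation problem. *)
Lemma quadratic_ge0_linear_coeff0 {R : realType} (d k : R) :
  0 <= k -> (forall s : R, 0 <= 2 * s * d + s ^+ 2 * k) -> d = 0.
Proof.
move=> k0 /(_ (- d / (k + 1))).
have k1 : k + 1 != 0 by rewrite gt_eqF //; lra.
have -> : 2 * (- d / (k + 1)) * d + (- d / (k + 1)) ^+ 2 * k
  = - (d ^+ 2 * ((k + 2) / (k + 1) ^+ 2)) by field.
rewrite oppr_ge0 pmulr_lle0 => [d2|]; last first.
  by rewrite divr_gt0 ?exprn_gt0 //; lra.
by apply/eqP; rewrite -sqrf_eq0 eq_le d2 sqr_ge0.
Qed.

(** * Riesz representation by minimisation *)

Definition conj_linear_on {R : realType} {V : lmodType R[i]} (E : V -> Prop)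
    (F : V -> R[i]) : Prop :=
  forall c y y', E y -> E y' -> F (c *: y + y') = conjc c * F y + F y'.

(** Two sets are kept apart so that limits may leave [E]: [E = E'] is completeness of [E], while a
    larger [E'] allows projections on the closure of [E]. Distances enter squared, through
    [qf g]. *)
Definition complete_in {R : realType} {V : lmodType R[i]} (E E' : V -> Prop)
    (g : V -> V -> R[i]) : Prop :=
  forall u : nat -> V, (forall n, E (u n)) ->
    (forall e : R, 0 < e -> exists N, forall m n, (N <= m)%N -> (N <= n)%N ->
        qf g (u m - u n) < e) ->
    exists x, E' x /\ forall e : R, 0 < e ->
      exists N, forall n, (N <= n)%N -> qf g (u n - x) < e.

Section ConjLinear.
Context {R : realType} {V : lmodType R[i]} {E : V -> Prop} (hE : subspace E).
Context {F : V -> R[i]} (hF : conj_linear_on E F).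

Lemma conj_linearD y y' : E y -> E y' -> F (y + y') = F y + F y'.
Proof. by move=> *; rewrite -{1}[y]scale1r hF // conjc1 mul1r. Qed.

Lemma conj_linear0 : F 0 = 0.
Proof.
have E0 := hE.1; have := conj_linearD E0 E0; rewrite addr0.
by move/eqP; rewrite -subr_eq0 opprD addNKr oppr_eq0 => /eqP.
Qed.

Lemma conj_linearZ c y : E y -> F (c *: y) = conjc c * F y.
Proof.
by move=> Ey; rewrite -[_ *: _]addr0 hF ?conj_linear0 ?addr0 //; exact: hE.1.
Qed.

End ConjLinear.

Section Riesz.
Context {R : realType} {V : lmodType R[i]} {E E' : V -> Prop}.
Context (hE : subspace E) (hE' : subspace E') (EE' : forall x, E x -> E' x).
Context {g : V -> V -> R[i]} (hg : sesquilinear_on E' g).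
Context (gs : symmetric_on E' g) (gp : psd_on E' g) (gc : complete_in E E' g).
Context {F : V -> R[i]} (hF : conj_linear_on E F).

(* The limit of a minimising sequence of [qf g y - 2 * Re (F y)] over [E];
   the sequence is Cauchy by the parallelogram identity. [E' = E] is the Riesz
   theorem; for the whole space [E'] and [F = ip z] the point [x] is the
   orthogonal projection of [z] on the closure of [E]. *)
Lemma riesz_in K :
  (forall y, E y -> 2 * complex.Re (F y) <= qf g y + K) ->
  exists x, [/\ E' x,
    (forall e : R, 0 < e -> exists u, E u /\ qf g (u - x) < e) &
    (forall y, E y -> g x y = F y)].
Proof.
move=> hK; pose J y := qf g y - 2 * complex.Re (F y).
pose S := [set r | exists y, E y /\ r = J y]%classic.
have Sinf : has_inf S.
  split; first by exists (J 0), 0; split => //; exact: hE.1.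
  by exists (- K) => _ [y [Ey ->]]; have := hK y Ey; rewrite /J; lra.
have Jinf y : E y -> inf S <= J y.
  by move=> Ey; apply: ge_inf; [exact: Sinf.2 | exists y].
have /choice[u hu] n : exists y, E y /\ J y < inf S + n.+1%:R^-1.
  have [|_ [y [Ey ->]] Jy] := @inf_adherent _ S n.+1%:R^-1 _ Sinf.
    by rewrite invr_gt0 ltr0n.
  by exists y.
have Eu n : E (u n) by exact: (hu n).1.
have JDZ s x y : E x -> E y -> J (x + (s%:C)%C *: y) =
    J x + 2 * s * (complex.Re (g x y) - complex.Re (F y)) + s ^+ 2 * qf g y.
  move=> Ex Ey; have Esy := subspaceZ hE (s%:C)%C Ey.
  rewrite /J (qfDZ hE' hg gs) ?(conj_linearD hF) ?(conj_linearZ hE hF) //; try by subsp.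
  by rewrite !complexD /=; ring.
have [|x [E'x ux]] := gc Eu.
  move=> e e0; have [|N hN] := @invn_small _ (e / 4); first lra.
  exists N => m n /hN Nm /hN Nn.
  (* Comparing [J] at the midpoint with its infimum gives [qf g (u m - u n) < 2 * (m.+1%:R^-1 +
     n.+1%:R^-1)], whence the choice [e / 4]. *)
  have Emid : E ((2^-1 : R)%:C%C *: (u m + u n)) by have := (Eu m, Eu n) => -[? ?]; subsp.
  have := Jinf _ Emid; have := (hu m).2; have := (hu n).2; rewrite /J.
  have Emn : E (u m + u n) by have := (Eu m, Eu n) => -[? ?]; subsp.
  have Um := EE' (Eu m); have Un := EE' (Eu n).
  rewrite (qfZ hE' hg gs) /= ?(conj_linearZ hE hF) //; last by subsp.
  rewrite (conj_linearD hF) // !complexD /= !oppr0 !mul0r subr0.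
  have := qf_parallelogram hE' hg gs Um Un.
  move: (qf g (u m + u n)) (qf g (u m - u n)) (complex.Re (F (u m)))
    (complex.Re (F (u n))) (qf g (u m)) (qf g (u n)) Nm Nn => p q r s a b.
  by move: (m.+1%:R^-1) (n.+1%:R^-1) => i j; lra.
exists x; split => //.
  by move=> e /ux[N hN]; exists (u N); split => //; apply: hN.
(* Real parts suffice: testing against ['i *: y] recovers the imaginary parts. *)
suff hRe y : E y -> complex.Re (g x y) = complex.Re (F y).
  move=> y Ey; apply: complex_ext; first exact: hRe.
  have := hRe _ (subspaceZ hE 'i%C Ey).
  rewrite (sesqZr hE' hg) ?(conj_linearZ hE hF) ?complexD //=; try by subsp.
  by rewrite /=; lra.
move=> Ey; apply/eqP; rewrite -subr_eq0; apply/eqP.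
have E'y := EE' Ey.
(* The limit [x] may lie outside [E], so [J] is varied at [u n] and not at [x]. Passing from [u n]
   to [x] costs [2 * s * Re (g (u n - x) y)], which is at most [qf g (u n - x) + s ^+ 2 * qf g y];
   this accounts for the factor 2 in the quadratic coefficient. *)
apply: (@quadratic_ge0_linear_coeff0 _ _ (2 * qf g y)).
  by rewrite mulr_ge0 // (qf_ge0 gp).
move=> s; apply/ler_addgt0Pr => e e0.
have [|N hN] := @invn_small _ (e / 2); first lra.
have [|N' hN'] := ux (e / 2); first lra.
pose n := maxn N N'.
have := hN n (leq_maxl _ _); have := hN' n (leq_maxr _ _); have := (hu n).2.
have Eusy : E (u n + (s%:C)%C *: y) by have := Eu n => ?; subsp.
have := Jinf _ Eusy; rewrite JDZ //.
have E'un := EE' (Eu n); have E'Nx := subspaceN hE' E'x.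
have E'unx := subspaceD hE' E'un E'Nx.
have := qfDZ hE' hg gs (- s) E'unx E'y.
have : 0 <= qf g (u n - x + ((- s)%:C)%C *: y) by apply: (qf_ge0 gp); subsp.
rewrite (sesqDl hg) // (sesqNl hE' hg) // !complexD.
by move: (n.+1%:R^-1) => i; lra.
Qed.
End Riesz.

(** Boundedness of [F] gives the lower bound required by [riesz_in] with [K = C]: by the
    arithmetic-geometric mean inequality [2 * Re (F y)] is at most [qf g y + C]. *)
Lemma riesz_bounded {R : realType} {V : lmodType R[i]} (E : V -> Prop)
    (g : V -> V -> R[i]) (F : V -> R[i]) (C : R) :
  subspace E -> sesquilinear_on E g -> symmetric_on E g -> psd_on E g ->
  complete_in E E g -> conj_linear_on E F -> 0 <= C ->
  (forall y, E y -> complex.Re (F y) ^+ 2 <= C * qf g y) ->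
  exists x, E x /\ forall y, E y -> g x y = F y.
Proof.
move=> hE hg gs gp gc hF C0 hC.
have [//|y Ey|x [Ex _ hx]] := riesz_in hE hE _ hg gs gp gc hF (K := C); last by exists x.
have q0 := qf_ge0 gp Ey; have := hC y Ey.
move: (complex.Re _) (qf g y) q0 => p q q0 pq.
rewrite leNgt; apply/negP => lt.
have : (q + C) ^+ 2 < (2 * p) ^+ 2 by rewrite ltr_pXn2r ?nnegrE //; lra.
by have := sqr_ge0 (q - C); nra.
Qed.

(** * Solvability of variational equations under an inf-sup condition *)

Section InfSup.
Context {R : realType} {V : lmodType R[i]} {E : V -> Prop} (hE : subspace E).
Context {g : V -> V -> R[i]} (hg : sesquilinear_on E g).
Context (gs : symmetric_on E g) (gp : psd_on E g).
Context (gd : forall x, E x -> qf g x <= 0 -> x = 0).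

Lemma form_sep x x' : E x -> E x' -> (forall y, E y -> g x y = g x' y) -> x = x'.
Proof.
move=> Ex Ex' H; have ENx' := subspaceN hE Ex'; have Exx' := subspaceD hE Ex ENx'.
apply/eqP; rewrite -subr_eq0; apply/eqP; apply: gd => //.
by rewrite /qf (sesqDl hg) // (sesqNl hE hg) // H // subrr.
Qed.

Context {B : V -> V -> R[i]} (hB : sesquilinear_on E B).

(* Babuska's inf-sup theorem. With [A] the operator of [B], i.e.
   [g (A x) y = B x y], solvability of [A x = f] follows from Riesz for the form
   [g (A x) (A y)], equivalent to [g]: it gives an [x] with [A x - f] orthogonal
   to the range of [A], and then the inf-sup condition forces [A x = f]. *)
Lemma inf_sup (S : V -> V) (F : V -> R[i]) (C K c C' : R) :
  complete_in E E g ->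
  0 <= C -> (forall x y, E x -> E y ->
    complex.Re (B x y) ^+ 2 <= C * qf g x * qf g y) ->
  (forall x, E x -> E (S x)) ->
  (forall r, E r -> exists x, E x /\ S x = r) ->
  0 <= K -> (forall x, E x -> qf g (S x) <= K * qf g x) ->
  0 < c -> (forall x, E x -> c * qf g x <= complex.Re (B x (S x))) ->
  conj_linear_on E F ->
  0 <= C' -> (forall y, E y -> complex.Re (F y) ^+ 2 <= C' * qf g y) ->
  exists x, E x /\ forall y, E y -> B x y = F y.
Proof.
move=> gc C0 hC ES Ssurj K0 hK c0 hc hF C'0 hC'.
(* [A x] comes from Riesz for the functional [B x]; outside [E] its value is an arbitrary
   default. *)
have /choice[A hA] x : exists z, E x -> E z /\ forall y, E y -> g z y = B x y.
  have [Ex|nEx] := pselect (E x); last by exists 0.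
  have [|||z hz] := @riesz_bounded _ _ _ _ (B x) (C * qf g x) hE hg gs gp gc; last by exists z.
  - by move=> k y y' Ey Ey'; rewrite hB.2.
  - by rewrite mulr_ge0 // (qf_ge0 gp).
  - by move=> y Ey; apply: hC.
have EA x : E x -> E (A x) by case/hA.
have gA x y : E x -> E y -> g (A x) y = B x y by move=> /hA[_]; apply.
have AL k x x' : E x -> E x' -> A (k *: x + x') = k *: A x + A x'.
  move=> Ex Ex'; have EAx := EA _ Ex; have EAx' := EA _ Ex'.
  apply: form_sep; [by subsp | by subsp |] => y Ey.
  have Ekx := subspaceZ hE k Ex.
  rewrite gA //; last by subsp.
  by rewrite hg.1 // hB.1 // !gA.
pose Q x y := g (A x) (A y).
have Q0 x : E x -> 0 <= qf g (A x) by move=> Ex; apply: (qf_ge0 gp); apply: EA.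
(* Boundedness of [B] at [y = A x], where [B x (A x) = g (A x) (A x)], followed by division by
   [qf g (A x)]. *)
have QC x : E x -> qf g (A x) <= C * qf g x.
  move=> Ex; have q0 := qf_ge0 gp Ex; have := hC _ _ Ex (EA _ Ex).
  rewrite -gA //; last exact: EA.
  have := Q0 _ Ex; rewrite -[complex.Re _]/(qf g (A x)).
  move: (qf g (A x)) (C * qf g x) (mulr_ge0 C0 q0) => p s s0.
  rewrite le_eqVlt => /orP[/eqP <- //|p0].
  by rewrite expr2 ler_pM2r.
(* In norms, [c |x|^2 <= Re g (A x) (S x) <= |A x| |S x| <= sqrt K |A x| |x|]. *)
have cQ x : E x -> c ^+ 2 * qf g x <= K * qf g (A x).
  move=> Ex; have q0 := qf_ge0 gp Ex; have := hc _ Ex; rewrite -gA //; last exact: ES.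
  have := cauchy_schwarz hE hg gs gp (EA _ Ex) (ES _ Ex).
  have := hK _ Ex; have := Q0 _ Ex; move: (complex.Re _) (qf g (S x)) => r s.
  move: q0; rewrite le_eqVlt => /orP[/eqP <- p0 _ _ _|q0 p0 sK rs cr].
    by rewrite mulr0 mulr_ge0.
  have : (c * qf g x) ^+ 2 <= r ^+ 2.
    by rewrite ler_pXn2r ?nnegrE // ?(le_trans _ cr) ?mulr_ge0 // ltW.
  by move=> h; rewrite -(ler_pM2r q0); have := ler_wpM2l p0 sK; nra.
have hQ : sesquilinear_on E Q.
  split=> [k x x' y Ex Ex' Ey|k x y y' Ex Ey Ey']; rewrite /Q AL //.
    by apply: hg.1; exact: EA.
  by apply: hg.2; exact: EA.
have Qs : symmetric_on E Q by move=> x y Ex Ey; apply: gs; exact: EA.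
have Qp : psd_on E Q by move=> x Ex; apply: gp; exact: EA.
(* Completeness passes from [g] to the equivalent form [Q]; [K + 1] and [C + 1] serve as
   denominators because [K] and [C] may be zero. *)
have Qc : complete_in E E Q.
  move=> u Eu uC; have [//|e e0|x [Ex ux]] := gc u.
    have [|N hN] := uC (c ^+ 2 * e / (K + 1)).
      by rewrite divr_gt0 ?mulr_gt0 ?exprn_gt0 //; lra.
    exists N => m n Nm Nn; have := hN m n Nm Nn.
    have Emn : E (u m - u n) by have := (Eu m, Eu n) => -[? ?]; subsp.
    have := cQ _ Emn; rewrite -[qf Q _]/(qf g (A _)) ltr_pdivlMr; last lra.
    have := Q0 _ Emn; move: (qf g (A _)) (qf g (u m - u n)) => p q p0 cq pK.
    rewrite -(@ltr_pM2l _ (c ^+ 2)) ?exprn_gt0 //; nra.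
  exists x; split => // e e0; have [|N hN] := ux (e / (C + 1)).
    by rewrite divr_gt0 //; lra.
  exists N => n Nn; have := hN n Nn.
  have Enx : E (u n - x) by have := Eu n => ?; subsp.
  have := QC _ Enx; rewrite -[qf Q _]/(qf g (A _)) ltr_pdivlMr; last lra.
  have := qf_ge0 gp Enx; move: (qf g (A _)) (qf g (u n - x)) => p q p0 cq pK; nra.
have [f [Ef hf]] := riesz_bounded hE hg gs gp gc hF C'0 hC'.
have hF' : conj_linear_on E (fun y => g f (A y)).
  by move=> k y y' Ey Ey'; rewrite AL // hg.2 //; exact: EA.
have [y Ey|x [Ex hx]] := riesz_bounded hE hQ Qs Qp Qc hF' (qf_ge0 gp Ef).
  by apply: (cauchy_schwarz hE hg gs gp Ef); exact: EA.
exists x; split=> // y Ey; rewrite -gA // -hf //; congr (g _ y).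
(* Write the residual [A x - f] as [S r']. Then [c * qf g r'] is at most [Re (B r' (S r')) = Re (g
   (A r') (A x - f))], which is zero by orthogonality, so [S r'] vanishes as well. *)
have EAx := EA _ Ex; have Er : E (A x - f) by subsp.
have [r' [Er' Sr']] := Ssurj _ Er.
apply/eqP; rewrite -subr_eq0; apply/eqP; apply: gd => //; rewrite -Sr'.
apply: le_trans (hK _ Er') _; rewrite mulr_ge0_le0 // -(pmulr_rle0 _ c0).
apply: le_trans (hc _ Er') _; rewrite Sr' -gA // (symRe gs) //; last exact: EA.
have EAr' := EA _ Er'; have ENf := subspaceN hE Ef.
by rewrite (sesqDl hg) // (sesqNl hE hg) // -[g (A x) _]/(Q x r') hx // subrr.
Qed.
End InfSup.

(** * Inner products: projection and density *)

Section InnerProduct.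
Context {R : realType} {V : lmodType R[i]} {ip : V -> V -> R[i]}.
Context (hip : inner_product ip).

Lemma inner_sesq E : sesquilinear_on E ip.
Proof.
have [lin sym _ _] := hip; split=> [c x x' y _ _ _|c x y y' _ _ _]; first exact: lin.
by rewrite sym lin conjcD conjcM -!sym.
Qed.

Lemma inner_sym E : symmetric_on E ip.
Proof. by have [_ sym _ _] := hip => x y _ _. Qed.

Lemma inner_psd E : psd_on E ip.
Proof. by have [_ _ pos _] := hip => x _. Qed.

Arguments inner_sesq E : clear implicits.
Arguments inner_sym E : clear implicits.
Arguments inner_psd E : clear implicits.

Lemma inner_ge0 x : 0 <= qf ip x.
Proof. exact: (@qf_ge0 _ _ (fun=> True) _ (inner_psd _)). Qed.

Lemma inner_def x : qf ip x <= 0 -> x = 0.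
Proof.
have [_ _ pos def] := hip => x0; apply: def; apply: complex_ext => /=.
  by apply/eqP; rewrite eq_le x0 inner_ge0.
exact: (@sym_diag_Im _ _ (fun=> True) _ (inner_sym _)).
Qed.

Lemma hnorm_lt x e : 0 < e -> (hnorm ip x < e) = (qf ip x < e ^+ 2).
Proof.
move=> e0; rewrite -[in RHS](sqr_sqrtr (inner_ge0 x)).
by rewrite ltr_pXn2r ?nnegrE ?sqrtr_ge0 // ltW.
Qed.

Lemma inner_product_sum : inner_product (ip_sum ip).
Proof.
have [lin sym pos _] := hip; split.
- by move=> c x y z; rewrite /ip_sum /= !lin; ring.
- by move=> x y; rewrite /ip_sum conjcD -!sym.
- by move=> x; rewrite addr_ge0.
- move=> x x0; have := congr1 (@complex.Re R) x0; rewrite ReD /=.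
  have := inner_ge0 x.1; have := inner_ge0 x.2; rewrite /qf => h1 h2 h.
  by case: x x0 h1 h2 h => x1 x2 /= _ h1 h2 h; congr (_, _); apply: inner_def; rewrite /qf; lra.
Qed.

Lemma complete_inner : complete ip -> complete_in (fun=> True) (fun=> True) ip.
Proof.
move=> ic u _ uC; have [e e0|x ux] := ic u.
  have [|N hN] := uC (e ^+ 2); first exact: exprn_gt0.
  by exists N => m n Nm Nn; rewrite hnorm_lt // hN.
exists x; split=> // e e0; have [|N hN] := ux (Num.sqrt e); first by rewrite sqrtr_gt0.
by exists N => n /hN; rewrite hnorm_lt ?sqrtr_gt0 // sqr_sqrtr // ltW.
Qed.

(** The point [p] is the orthogonal projection of [x] on the closure of [E]; the lower bound needed
    by [riesz_in] is [0 <= qf ip (x - y)]. *)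
Lemma hilbert_riesz (E : V -> Prop) x : subspace E -> complete ip ->
  exists p, (forall e : R, 0 < e -> exists u, E u /\ qf ip (u - p) < e) /\
    forall y, E y -> ip p y = ip x y.
Proof.
move=> hE ic.
have hT : subspace (fun _ : V => True) by [].
have gc : complete_in E (fun=> True) ip.
  by move=> u _ uC; apply: (complete_inner ic).
have [//|||p [_ p1 p2]] := @riesz_in _ _ _ _ hE hT _ _ (inner_sesq _) (inner_sym _) (inner_psd _) gc (ip x) _ (qf ip x).
- by move=> k y y' _ _; apply: (inner_sesq (fun=> True)).2.
- move=> y _; have := inner_ge0 (x - y).
  by rewrite (qfB hT (inner_sesq _) (inner_sym _)) //; lra.
by exists p.
Qed.

(** The difference between [x] and its projection on the closure of [E] is orthogonal to [E], hence
    zero, so [x] lies in that closure. *)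
Lemma dense_of_orthogonal (E : V -> Prop) : subspace E -> complete ip ->
  (forall x, (forall y, E y -> ip x y = 0) -> x = 0) -> dense ip E.
Proof.
move=> hE ic orth x e e0; have hT : subspace (fun _ : V => True) by [].
have [p [p1 p2]] := hilbert_riesz x hE ic.
have : x - p = 0.
  apply: orth => y Ey; have hs := inner_sesq (fun=> True).
  by rewrite (sesqDl hs) // (sesqNl hT hs) // p2 // subrr.
move/eqP; rewrite subr_eq0 => /eqP ->.
have [|u [Eu up]] := p1 (e ^+ 2); first exact: exprn_gt0.
exists u; split=> //; rewrite hnorm_lt // -opprB.
by rewrite (qfN hT (inner_sesq _)).
Qed.

(** By Pythagoras every [d] in [E] is at distance at least [|x|] from [x], which contradicts density
    unless [x = 0]. *)
Lemma orthogonal_of_dense (E : V -> Prop) x : dense ip E ->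
  (forall y, E y -> ip x y = 0) -> x = 0.
Proof.
move=> dE xE; apply: inner_def; rewrite leNgt; apply/negP => x0.
have hT : subspace (fun _ : V => True) by [].
have [|d [Ed]] := dE x (Num.sqrt (qf ip x)); first by rewrite sqrtr_gt0.
rewrite hnorm_lt ?sqrtr_gt0 // sqr_sqrtr; last exact: inner_ge0.
rewrite (qfB hT (inner_sesq _) (inner_sym _)) // xE //=.
by have := inner_ge0 d; lra.
Qed.

End InnerProduct.

Arguments inner_sesq {R V ip} hip E.
Arguments inner_sym {R V ip} hip E.
Arguments inner_psd {R V ip} hip E.

(** * Sums of forms, direct sums, and completeness in the form norm *)

Section Sum.
Context {R : realType} {V : lmodType R[i]} {D : V -> Prop}.

Lemma sesq_add f g : sesquilinear_on D f -> sesquilinear_on D g ->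
  sesquilinear_on D (fun x y : V => f x y + g x y).
Proof.
move=> hf hg; split=> [c x x' y Dx Dx' Dy|c x y y' Dx Dy Dy'].
  by rewrite hf.1 // hg.1 //; ring.
by rewrite hf.2 // hg.2 //; ring.
Qed.

Lemma sym_add f g : symmetric_on D f -> symmetric_on D g ->
  symmetric_on D (fun x y : V => f x y + g x y).
Proof. by move=> hf hg x y Dx Dy; rewrite conjcD -hf // -hg. Qed.

Lemma psd_add f g : psd_on D f -> psd_on D g ->
  psd_on D (fun x y : V => f x y + g x y).
Proof. by move=> hf hg x Dx; rewrite addr_ge0 ?hf ?hg. Qed.

Lemma qf_add f g (x : V) : qf (fun x y => f x y + g x y) x = qf f x + qf g x.
Proof. exact: ReD. Qed.

Lemma qf_sum f (x : V * V) : qf (ip_sum f) x = qf f x.1 + qf f x.2.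
Proof. exact: ReD. Qed.

Context {f : V -> V -> R[i]}.

Lemma sesq_sum : sesquilinear_on D f -> sesquilinear_on (dom_sum D) (ip_sum f).
Proof.
move=> hf; split=> [c x x' y [? ?] [? ?] [? ?]|c x y y' [? ?] [? ?] [? ?]]; rewrite /ip_sum /=.
  by rewrite !hf.1 //; ring.
by rewrite !hf.2 //; ring.
Qed.

Lemma sym_sum : symmetric_on D f -> symmetric_on (dom_sum D) (ip_sum f).
Proof. by move=> hf x y [? ?] [? ?]; rewrite /ip_sum conjcD -!hf. Qed.

Lemma psd_sum : psd_on D f -> psd_on (dom_sum D) (ip_sum f).
Proof. by move=> hf x [? ?]; rewrite addr_ge0 ?hf. Qed.

Lemma complete_sum : subspace D -> psd_on D f ->
  complete_in D D f -> complete_in (dom_sum D) (dom_sum D) (ip_sum f).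
Proof.
move=> hD fp fc u Du uC.
have D1 n : D (u n).1 by case: (Du n).
have D2 n : D (u n).2 by case: (Du n).
have DB (v : nat -> V) m n : (forall n, D (v n)) -> D (v m - v n).
  by move=> Dv; have := (Dv m, Dv n) => -[? ?]; subsp.
have [e /uC[N hN]|x1 [Dx1 h1]] := fc _ D1.
  exists N => m n Nm Nn; apply: le_lt_trans (hN m n Nm Nn).
  by rewrite qf_sum lerDl; apply: (qf_ge0 fp); apply: (DB (fun n => (u n).2)).
have [e /uC[N hN]|x2 [Dx2 h2]] := fc _ D2.
  exists N => m n Nm Nn; apply: le_lt_trans (hN m n Nm Nn).
  by rewrite qf_sum lerDr; apply: (qf_ge0 fp); apply: (DB (fun n => (u n).1)).
exists (x1, x2); split=> // e e0.
have [|N1 hN1] := h1 (e / 2); first lra.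
have [|N2 hN2] := h2 (e / 2); first lra.
exists (maxn N1 N2) => n; rewrite geq_max => /andP[/hN1 n1 /hN2 n2].
by rewrite qf_sum /=; lra.
Qed.

End Sum.

(** A sequence that is Cauchy for [ip + t] is Cauchy for [ip] and for [t] separately. Completeness
    of the Hilbert space provides the limit, and closedness puts it in [D] with convergence in
    [t]. *)
Lemma closed_form_complete {R : realType} {V : lmodType R[i]}
    (ip : V -> V -> R[i]) (D : V -> Prop) (t : V -> V -> R[i]) :
  is_hilbert ip -> subspace D -> sesquilinear_on D t -> psd_on D t -> closed_form ip D t ->
  complete_in D D (fun x y => ip x y + t x y).
Proof.
move=> [hip ic] hD ht tp tc u Du uC.
have hT : subspace (fun _ : V => True) by [].
have DB m n : D (u m - u n) by have := (Du m, Du n) => -[? ?]; subsp.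
have norm_t x e : D x -> (`|t x x| < (e%:C)%C) = (qf t x < e).
  move=> Dx; rewrite ger0_norm; last exact: tp.
  have := tp _ Dx; rewrite lecE ltcE /= /qf => /andP[/eqP -> _].
  by rewrite eqxx.
have [//|e /uC[N hN]|x [_ ux]] := complete_inner hip ic (u := u).
  exists N => m n Nm Nn; apply: le_lt_trans (hN m n Nm Nn).
  by rewrite qf_add lerDl (qf_ge0 tp).
have uconv : converges_to ip u x.
  move=> e e0; have [|N hN] := ux (e ^+ 2); first exact: exprn_gt0.
  by exists N => n Nn; rewrite hnorm_lt // hN.
have [e /uC[N hN]|Dx tx] := tc u x Du uconv.
  exists N => m n Nm Nn; rewrite norm_t //; apply: le_lt_trans (hN n m Nn Nm).
  by rewrite qf_add lerDr (inner_ge0 hip).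
exists x; split=> // e e0.
have [|N1 hN1] := ux (e / 2); first lra.
have [|N2 hN2] := tx (e / 2); first lra.
exists (maxn N1 N2) => n; rewrite geq_max => /andP[/hN1 n1 /hN2].
rewrite norm_t; last by have := Du n => ?; subsp.
by rewrite qf_add; lra.
Qed.

(** * The twist and the block form [h] *)

Definition twist {R : realType} {V : lmodType R[i]} (al be : R) (x : V * V) : V * V :=
  ((al%:C)%C *: x.1 + (be%:C)%C *: x.2, (be%:C)%C *: x.1 - (al%:C)%C *: x.2).

Section Twist.
Context {R : realType} {V : lmodType R[i]} {D : V -> Prop} (hD : subspace D).
Implicit Types al be : R.

Lemma dom_twist al be x : dom_sum D x -> dom_sum D (twist al be x).
Proof. by case=> D1 D2; split; rewrite /=; subsp. Qed.

(** The twist is the block matrix of [h] with numbers in place of forms: real symmetric, with square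
    [al ^+ 2 + be ^+ 2] times the identity. The cross terms of the two components cancel. *)
Lemma qf_twist f al be x : sesquilinear_on D f -> symmetric_on D f -> dom_sum D x ->
  qf (ip_sum f) (twist al be x) = (al ^+ 2 + be ^+ 2) * qf (ip_sum f) x.
Proof.
move=> hf fs [D1 D2].
have Da1 := subspaceZ hD (al%:C)%C D1; have Da2 := subspaceZ hD (al%:C)%C D2.
have Db1 := subspaceZ hD (be%:C)%C D1; have Db2 := subspaceZ hD (be%:C)%C D2.
rewrite !qf_sum /= (qfD hD hf fs) // (qfB hD hf fs) // !(qfZ hD hf fs) //.
by rewrite !(sesqZl hD hf) // !(sesqZr hD hf) // !complexD /=; ring.
Qed.

(** The cross terms [f x.1 x.2] and [f x.2 x.1] are conjugate to each other, and the diagonal terms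
    are real. *)
Lemma Im_twist f x : sesquilinear_on D f -> symmetric_on D f -> dom_sum D x ->
  complex.Im (ip_sum f x (twist 1 1 x)) = 0.
Proof.
move=> hf fs [D1 D2]; have DN2 := subspaceN hD D2.
rewrite /ip_sum /twist /= !scale1r !(sesqDr hf) // (sesqNr hD hf) // (fs x.2 x.1) //.
by rewrite !complexD !(sym_diag_Im fs) //; ring.
Qed.

Lemma twistK (x : V * V) : twist 1 1 (twist 1 1 x) = ((2 : R)%:C)%C *: x.
Proof.
case: x => x1 x2; rewrite /twist /= !scale1r addrACA subrr addr0 opprB [x2 - x1]addrC.
rewrite addrACA subrr add0r -(mulr2n x1) -(mulr2n x2) -(scaler_nat 2 x1) -(scaler_nat 2 x2).
have -> : ((2 : R)%:C)%C = 2 by apply: complex_ext; rewrite //= addr0.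
by [].
Qed.

Lemma twistZ c (x : V * V) : twist 1 1 (c *: x) = c *: twist 1 1 x.
Proof.
by apply: injective_projections; rewrite /= !scale1r ?scalerDr ?scalerN.
Qed.

Lemma twistB (x y : V * V) : twist 1 1 (x - y) = twist 1 1 x - twist 1 1 y.
Proof.
by apply: injective_projections; rewrite /= !scale1r ?opprD ?opprK addrACA.
Qed.

Context {a b : V -> V -> R[i]}.
Context (ha : sesquilinear_on D a) (sa : symmetric_on D a).
Context (hb : sesquilinear_on D b) (sb : symmetric_on D b).

Lemma hform_sesq : sesquilinear_on (dom_sum D) (hform a b).
Proof.
split=> [c x x' y [? ?] [? ?] [? ?]|c x y y' [? ?] [? ?] [? ?]]; rewrite /hform /=.
  by rewrite !ha.1 // !hb.1 //; ring.
by rewrite !ha.2 // !hb.2 //; ring.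
Qed.

Lemma hform_sym : symmetric_on (dom_sum D) (hform a b).
Proof.
move=> x y [? ?] [? ?]; rewrite /hform !conjcD conjcN -!sa // -!sb //.
by ring.
Qed.

(** The mixed terms pair up as [be * (a x.1 x.2 - a x.2 x.1)] and [al * (b x.2 x.1 - b x.1 x.2)],
    which are purely imaginary by symmetry. *)
Lemma Re_hform_twist al be x : dom_sum D x ->
  complex.Re (hform a b x (twist al be x)) =
    al * qf (ip_sum a) x + be * qf (ip_sum b) x.
Proof.
move=> [D1 D2]; rewrite /hform /=.
have Da1 := subspaceZ hD (al%:C)%C D1; have Da2 := subspaceZ hD (al%:C)%C D2.
have Db1 := subspaceZ hD (be%:C)%C D1; have Db2 := subspaceZ hD (be%:C)%C D2.
have DN := subspaceN hD Da2.
rewrite !(sesqDr ha) // !(sesqDr hb) // !(sesqNr hD ha) // !(sesqNr hD hb) //.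
rewrite !(sesqZr hD ha) // !(sesqZr hD hb) // (sa D2 D1) (sb D2 D1).
by rewrite !complexD !qf_sum /qf /=; ring.
Qed.

End Twist.

(** * Solvability of the shifted equation for [h] *)

Section Shift.
Context {R : realType} {V : lmodType R[i]} {ip : V -> V -> R[i]} {D : V -> Prop}.
Context {a b : V -> V -> R[i]} (hip : is_hilbert ip) (hD : subspace D).
Context (ha : sesquilinear_on D a) (sa : symmetric_on D a) (pa : psd_on D a).
Context (hb : sesquilinear_on D b) (sb : symmetric_on D b) (pb : psd_on D b).
Context (tc : closed_form ip D (fun x y => a x y + b x y)).

Local Notation h := (hform a b).
Local Notation E := (dom_sum D).
Local Notation g := (ip_sum (fun x y => ip x y + (a x y + b x y))).

Let hE : subspace E. Proof. exact: subspace_sum. Qed.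
Let hi : inner_product ip. Proof. exact: hip.1. Qed.
Let hg1 : sesquilinear_on D (fun x y => ip x y + (a x y + b x y)).
Proof. by apply: sesq_add; [exact: inner_sesq | exact: sesq_add]. Qed.
Let sg1 : symmetric_on D (fun x y => ip x y + (a x y + b x y)).
Proof. by apply: sym_add; [exact: inner_sym | exact: sym_add]. Qed.
Let pg1 : psd_on D (fun x y => ip x y + (a x y + b x y)).
Proof. by apply: psd_add; [exact: inner_psd | exact: psd_add]. Qed.
Let hW := inner_product_sum hi.

Let qg x : qf g x = qf (ip_sum ip) x + (qf (ip_sum a) x + qf (ip_sum b) x).
Proof. by rewrite !qf_sum !qf_add; ring. Qed.

Let qa0 x : E x -> 0 <= qf (ip_sum a) x. Proof. exact: (qf_ge0 (psd_sum pa)). Qed.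
Let qb0 x : E x -> 0 <= qf (ip_sum b) x. Proof. exact: (qf_ge0 (psd_sum pb)). Qed.
Let qi0 x : 0 <= qf (ip_sum ip) x. Proof. exact: inner_ge0. Qed.

(** Each of the four terms of [h] has squared real part at most [qf g x * qf g y], because [a] and
    [b] are dominated by [ip + a + b]. The square of a sum of four terms is at most four times the
    sum of their squares, whence 16. *)
Lemma hform_bound x y : E x -> E y -> complex.Re (h x y) ^+ 2 <= 16 * qf g x * qf g y.
Proof.
move=> [Dx1 Dx2] [Dy1 Dy2].
have B f (hf : sesquilinear_on D f) (sf : symmetric_on D f) (pf : psd_on D f) u v :
    (forall z, D z -> qf f z <= qf ip z + (qf a z + qf b z)) ->
    (u = x.1 \/ u = x.2) -> (v = y.1 \/ v = y.2) ->
    complex.Re (f u v) ^+ 2 <= qf g x * qf g y.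
  move=> fle ux vy.
  have Du : D u by case: ux => ->.
  have Dv : D v by case: vy => ->.
  apply: le_trans (cauchy_schwarz hD hf sf pf Du Dv) _.
  have qg0 z : D z -> 0 <= qf ip z + (qf a z + qf b z).
    by move=> Dz; have := qf_ge0 pg1 Dz; rewrite !qf_add.
  apply: ler_pM; rewrite ?(qf_ge0 pf) //.
    apply: le_trans (fle _ Du) _; rewrite qf_sum !qf_add.
    by case: ux => ->; rewrite ?lerDl ?lerDr; apply: qg0.
  apply: le_trans (fle _ Dv) _; rewrite qf_sum !qf_add.
  by case: vy => ->; rewrite ?lerDl ?lerDr; apply: qg0.
have La z : D z -> qf a z <= qf ip z + (qf a z + qf b z).
  by move=> Dz; have := qf_ge0 pb Dz; have := inner_ge0 hi z; lra.
have Lb z : D z -> qf b z <= qf ip z + (qf a z + qf b z).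
  by move=> Dz; have := qf_ge0 pa Dz; have := inner_ge0 hi z; lra.
have := B _ ha sa pa x.1 y.1 La (or_introl erefl) (or_introl erefl).
have := B _ ha sa pa x.2 y.2 La (or_intror erefl) (or_intror erefl).
have := B _ hb sb pb x.2 y.1 Lb (or_intror erefl) (or_introl erefl).
have := B _ hb sb pb x.1 y.2 Lb (or_introl erefl) (or_intror erefl).
rewrite /hform !complexD -mulrA; move: (qf g x * qf g y) => M.
move: (complex.Re (a _ _)) (complex.Re (a _ _)) (complex.Re (b _ _)) (complex.Re (b _ _)).
move=> p s q r.
have := sqr_ge0 (p - q); have := sqr_ge0 (p - r); have := sqr_ge0 (p + s).
have := sqr_ge0 (q - r); have := sqr_ge0 (q + s); have := sqr_ge0 (r + s).
by rewrite !expr2; lra.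
Qed.

(* Testing [h + i mu] against [twist 1 1 x + i mu x] gives [t + mu^2 |x|^2],
   because [h] is real on the diagonal and [twist 1 1] is symmetric for [ip]. *)
Lemma shifted_solvable (mu c : R) : 0 < c ->
  (forall x, E x -> c * qf g x <=
     qf (ip_sum a) x + qf (ip_sum b) x + mu ^+ 2 * qf (ip_sum ip) x) ->
  forall f, exists x, E x /\ forall y, E y ->
    h x y + Complex 0 mu * ip_sum ip x y = ip_sum ip f y.
Proof.
move=> c0 hc f; set k := Complex 0 mu.
have hi1 := inner_sesq hW E; have si1 := inner_sym hW E.
have hh := hform_sesq ha hb; have sh := hform_sym sa sb.
have hgE : sesquilinear_on E g := sesq_sum hg1.
have sgE : symmetric_on E g := sym_sum sg1.
have pgE : psd_on E g := psd_sum pg1.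
have gle x : E x -> qf (ip_sum ip) x <= qf g x.
  by move=> Ex; rewrite qg lerDl addr_ge0 ?qa0 ?qb0.
have gd x : E x -> qf g x <= 0 -> x = 0.
  by move=> Ex qx; apply: (inner_def hW); apply: le_trans (gle x Ex) qx.
have gc : complete_in E E g.
  apply: complete_sum => //; apply: closed_form_complete => //.
    exact: sesq_add.
  exact: psd_add.
pose B x y := h x y + k * ip_sum ip x y.
pose S (x : V * V) := twist 1 1 x + k *: x.
have hB : sesquilinear_on E B.
  split=> [l x x' y Ex Ex' Ey|l x y y' Ex Ey Ey']; rewrite /B.
    by rewrite hh.1 // hi1.1 //; ring.
  by rewrite hh.2 // hi1.2 //; ring.
have Et x : E x -> E (twist 1 1 x) by exact: dom_twist.
have ES x : E x -> E (S x) by move=> Ex; have := Et _ Ex => ?; rewrite /S; subsp.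
have n0 : 2 + mu ^+ 2 != 0 by rewrite gt_eqF //; have := sqr_ge0 mu; lra.
(* Both [C] and [K] come from [(p + q)^2 <= 2 p^2 + 2 q^2]: [C] doubles 16 and [mu ^+ 2], while [K]
   doubles the factor 2 of [qf_twist] and [mu ^+ 2]. *)
apply: (inf_sup hE hgE sgE pgE gd hB (S := S) (C := 32 + 2 * mu ^+ 2)
  (K := 4 + 2 * mu ^+ 2) (c := c) (C' := qf (ip_sum ip) f) gc) => //.
- by have := sqr_ge0 mu; lra.
- move=> x y Ex Ey; have := hform_bound Ex Ey; rewrite /B.
  have := cauchy_schwarz_Im hE hi1 si1 (inner_psd hW E) Ex Ey.
  have := ler_pM (qi0 x) (qi0 y) (gle _ Ex) (gle _ Ey).
  rewrite -!mulrA; move: (qf g x * qf g y) (qf (ip_sum ip) x * qf (ip_sum ip) y) => M N NM.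
  move: (h x y) (ip_sum ip x y) => p q qN pM.
  rewrite !complexD /= mul0r sub0r; move: (complex.Re p) (complex.Im q) qN pM => {}p {}q qN pM.
  have := ler_wpM2l (sqr_ge0 mu) (le_trans qN NM); have := sqr_ge0 (p + mu * q).
  by move: pM; rewrite !expr2; lra.
- move=> r Er; have Etr := Et _ Er.
  (* The preimage under [S = twist 1 1 + k]: since [twist 1 1] squares to 2 and [k] to [- mu ^+ 2],
     the product of [twist 1 1 + k] and [twist 1 1 - k] is [2 + mu ^+ 2]. *)
  pose w := (((2 + mu ^+ 2)^-1)%:C)%C *: (twist 1 1 r - k *: r).
  exists w; split; first by rewrite /w; subsp.
  have kk : k * k = ((- mu ^+ 2)%:C)%C.
    by apply: complex_ext; rewrite !complexD /=; ring.
  rewrite /S /w twistZ twistB twistZ twistK scalerA mulrC -scalerA -scalerDr scalerBr.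
  rewrite addrA subrK scalerA kk -scalerBl scalerA -rmorphB -rmorphM /= opprK mulVf //.
  by rewrite scale1r.
- by have := sqr_ge0 mu; lra.
- move=> x Ex; have Etx := Et _ Ex; have Ekx := subspaceZ hE k Ex.
  apply: le_trans (qfD_le hE hgE sgE pgE Etx Ekx) _.
  rewrite (qf_twist hD) // (qfZ hE hgE sgE) //=.
  by rewrite le_eqVlt; apply/orP; left; apply/eqP; ring.
- move=> x Ex; have Etx := Et _ Ex; have Ekx := subspaceZ hE k Ex.
  apply: le_trans (hc _ Ex) _.
  rewrite /B /S (sesqDr hh) // (sesqDr hi1) // (sesqZr hE hh) // (sesqZr hE hi1) //.
  have := Re_hform_twist hD ha sa hb sb 1 1 Ex; have := sym_diag_Im sh Ex.
  have := Im_twist hD (inner_sesq hi _) (inner_sym hi _) Ex; have := sym_diag_Im si1 Ex.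
  rewrite -[qf (ip_sum ip) x]/(complex.Re (ip_sum ip x x)).
  move: (h x (twist 1 1 x)) (ip_sum ip x (twist 1 1 x)) (h x x) (ip_sum ip x x).
  move=> p q r s s0 q0 r0 p0; rewrite !complexD /= s0 q0 r0 p0.
  by rewrite le_eqVlt; apply/orP; left; apply/eqP; ring.
- by move=> l y y' Ey Ey'; apply: (inner_sesq hW (fun=> True)).2.
- move=> y Ey.
  have hT : subspace (fun _ : V * V => True) by [].
  apply: le_trans (cauchy_schwarz hT (inner_sesq hW _) (inner_sym hW _) (inner_psd hW _) I I) _.
  by rewrite ler_wpM2l // gle.
Qed.

End Shift.

(** * The operator attached to a symmetric form *)

Section FormOperator.
Context {R : realType} {W : lmodType R[i]} {ip : W -> W -> R[i]}.
Context (hip : inner_product ip) {E : W -> Prop} (hE : subspace E).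
Context (Esep : forall x, (forall y, E y -> ip x y = 0) -> x = 0).
Context {h : W -> W -> R[i]} (hh : sesquilinear_on E h) (sh : symmetric_on E h).

(** The largest operator represented by [h]. [Esep] makes the chosen value unique on the domain;
    elsewhere [xget] returns 0. *)
Definition form_operator : operator W :=
  Op (fun x => E x /\ exists z, forall y, E y -> h x y = ip z y)
     (fun x => xget 0 [set z | forall y, E y -> h x y = ip z y]%classic).

Local Notation T := form_operator.

Let hT : subspace (fun _ : W => True). Proof. by []. Qed.
Let hs := inner_sesq hip (fun=> True).
Let ss := inner_sym hip (fun=> True).

Lemma ip_sep z z' : (forall y, E y -> ip z y = ip z' y) -> z = z'.
Proof.
move=> H; apply/eqP; rewrite -subr_eq0; apply/eqP; apply: Esep => y Ey.
by rewrite (sesqDl hs) // (sesqNl hT hs) // H // subrr.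
Qed.

Lemma form_operatorP x y : op_dom T x -> E y -> h x y = ip (op_app T x) y.
Proof. by move=> [_ xz] Ey; exact: (@xgetPex _ 0 _ xz y Ey). Qed.

Lemma form_operator_intro x z : E x -> (forall y, E y -> h x y = ip z y) ->
  op_dom T x /\ op_app T x = z.
Proof.
move=> Ex hz; have Tx : op_dom T x by split=> //; exists z.
by split=> //; apply: ip_sep => y Ey; rewrite -form_operatorP ?hz.
Qed.

Lemma form_operator_comb c x y : op_dom T x -> op_dom T y ->
  op_dom T (c *: x + y) /\ op_app T (c *: x + y) = c *: op_app T x + op_app T y.
Proof.
move=> Tx Ty; have [Ex _] := Tx; have [Ey _] := Ty.
apply: form_operator_intro; first by subsp.
by move=> z Ez; rewrite hh.1 // !form_operatorP // hs.1.
Qed.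

Lemma form_operator_linear : linear_operator T.
Proof.
split; last by move=> c x y Tx Ty; apply: (form_operator_comb c Tx Ty).2.
split; last by move=> c x y Tx Ty; apply: (form_operator_comb c Tx Ty).1.
apply: (form_operator_intro (z := 0) hE.1 _).1 => y Ey.
by rewrite (sesq0l hE hh) // (sesq0l hT hs).
Qed.

Lemma form_operator_symmetric x y : op_dom T x -> op_dom T y ->
  ip (op_app T x) y = ip x (op_app T y).
Proof.
move=> Tx Ty; have [Ex _] := Tx; have [Ey _] := Ty.
by rewrite -form_operatorP // sh // form_operatorP // -ss.
Qed.

Lemma form_operator_represents : represents ip E h T.
Proof. by split=> [x []|x y Tx Ey] //; apply: form_operatorP. Qed.

Context (icomp : complete ip).
Context (solv : forall mu : R, mu ^+ 2 = 1 -> forall f, exists x, E x /\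
  forall y, E y -> h x y + Complex 0 mu * ip x y = ip f y).

Lemma form_operator_shift_surj mu f : mu ^+ 2 = 1 ->
  exists x, op_dom T x /\ op_app T x + Complex 0 mu *: x = f.
Proof.
move=> mu1; have [x [Ex hx]] := solv mu1 f.
have [|Tx Ax] := form_operator_intro (z := f - Complex 0 mu *: x) Ex.
  move=> y Ey; rewrite (sesqDl hs) // (sesqNl hT hs) // (sesqZl hT hs) //.
  by rewrite -hx // addrK.
by exists x; rewrite Ax subrK.
Qed.

(* A symmetric operator with [T + i] and [T - i] both
   surjective is selfadjoint. *)
Lemma form_operator_selfadjoint : selfadjoint ip T.
Proof.
have opp1 : (- 1 : R) ^+ 2 = 1 by rewrite sqrrN expr1n.
have conji : conjc (Complex 0 (- 1 : R)) = Complex 0 1 by rewrite /= opprK.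
split; [exact: form_operator_linear | | | exact: form_operator_symmetric].
  apply: dense_of_orthogonal => //; first exact: form_operator_linear.1.
  (* Solve [(T + i) g = f] and [(T - i) x = g]. By symmetry [ip g g = ip f x], which is zero because
     [f] is orthogonal to the domain; so [g = 0] and [f = 0]. *)
  move=> f fT; have [g [Tg gf]] := form_operator_shift_surj f (expr1n R 2).
  suff -> : f = 0 by [].
  have g0 : g = 0.
    apply: (inner_def hip); have [x [Tx xg]] := form_operator_shift_surj g opp1.
    rewrite /qf -{2}xg (sesqDr hs) // (sesqZr hT hs) // conji.
    rewrite -form_operator_symmetric // -(sesqZl hT hs) // -(sesqDl hs) // gf fT //.
  rewrite -gf g0 scaler0 addr0.
  by have := form_operator_comb (-1) Tg Tg; rewrite g0 scaler0 addr0 scaleN1r addNr => -[].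
move=> y; split=> [[z hz]|Ty]; last first.
  by exists (op_app T y) => x Tx; apply: form_operator_symmetric.
(* Here [z] is the adjoint's value at [y]. With [(T + i) w = z + i y], the vector [y - w] is
   orthogonal to the range of [T - i], which is the whole space. *)
have [w [Tw hw]] := form_operator_shift_surj (z + Complex 0 1 *: y) (expr1n R 2).
suff -> : y = w by [].
apply/eqP; rewrite -subr_eq0; apply/eqP; apply: (inner_def hip).
have [x [Tx hx]] := form_operator_shift_surj (y - w) opp1.
have eqs : ip (y - w) y = ip (y - w) w.
  rewrite -hx !(sesqDl hs) // !(sesqZl hT hs) // hz // (form_operator_symmetric Tx Tw).
  have -> : Complex 0 (- 1 : R) = conjc (Complex 0 1) by [].
  by rewrite -!(sesqZr hT hs) // -!(sesqDr hs) // hw.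
by rewrite /qf (sesqDr hs) // (sesqNr hT hs) // eqs subrr.
Qed.

(** Maximality of [T] gives that [T] extends [T']. Then, by symmetry of [T], its domain lies in the
    adjoint domain of [T'], which is the domain of [T']. *)
Lemma form_operator_unique T' : selfadjoint ip T' -> represents ip E h T' ->
  same_operator T T'.
Proof.
move=> [_ _ adj sym'] [domE rep].
have sub x : op_dom T' x -> op_dom T x /\ op_app T x = op_app T' x.
  by move=> Tx; apply: form_operator_intro; [exact: domE | move=> y Ey; exact: rep].
have sup x : op_dom T x -> op_dom T' x.
  move=> Tx; apply/adj; exists (op_app T x) => y Ty.
  by have [Ty' <-] := sub y Ty; apply: form_operator_symmetric.
by split=> [x|x /sup /sub[]//]; split=> [/sup|/sub[]].
Qed.

(** Solvability gives surjectivity; the lower bound gives injectivity, from which linearity of the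
    inverse follows, and also its norm bound. *)
Lemma form_operator_bounded_inverse (s : R) : 0 < s ->
  (forall f, exists x, E x /\ forall y, E y -> h x y = ip f y) ->
  (forall x, op_dom T x -> s * hnorm ip x <= hnorm ip (op_app T x)) ->
  bounded_inverse_norm_le ip T (1 / s).
Proof.
move=> s0 surj low.
have /choice[G hG] f : exists x, op_dom T x /\ op_app T x = f.
  by have [x [Ex hx]] := surj f; exists x; apply: form_operator_intro.
have inj x x' : op_dom T x -> op_dom T x' -> op_app T x = op_app T x' -> x = x'.
  move=> Tx Tx' e; have [Td Ad] := form_operator_comb (-1) Tx' Tx.
  have := low _ Td; rewrite Ad e !scaleN1r addNr addrC => n0.
  apply/eqP; rewrite -subr_eq0; apply/eqP; apply: (inner_def hip).
  have h0 : hnorm ip 0 = 0 by rewrite /hnorm (sesq0l hT hs) // sqrtr0.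
  by move: n0; rewrite h0 (pmulr_rle0 _ s0) => n0; rewrite leNgt -sqrtr_gt0 -leNgt.
exists G; split=> //.
- by move=> x Tx; apply: inj => //; [exact: (hG _).1 | exact: (hG _).2].
- move=> k y z; have [Tc Ac] := form_operator_comb k (hG y).1 (hG z).1.
  by apply: inj => //; [exact: (hG _).1 | rewrite Ac !(hG _).2].
- move=> y; have := low _ (hG y).1; rewrite (hG y).2 => low_y.
  by rewrite div1r mulrC ler_pdivlMr // mulrC.
Qed.

End FormOperator.

(** * Assembly on [V * V]: selfadjointness, uniqueness and the inverse *)

Theorem theorem4p1 (R : realType) (V : lmodType R[i]) (ip : V -> V -> R[i])
    (D : V -> Prop) (a b : V -> V -> R[i]) (alpha beta : R) :
  is_hilbert ip ->
  subspace D -> dense ip D ->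
  sesquilinear_on D a -> symmetric_on D a -> psd_on D a ->
  sesquilinear_on D b -> symmetric_on D b -> psd_on D b ->
  0 <= alpha -> 0 <= beta ->
  lower_bound_on ip D a alpha -> lower_bound_on ip D b beta ->
  closed_form ip D (fun x y => a x y + b x y) ->
  exists H : operator (V * V),
    [/\ selfadjoint (ip_sum ip) H,
        represents (ip_sum ip) (dom_sum D) (hform a b) H,
        (forall H' : operator (V * V),
           selfadjoint (ip_sum ip) H' ->
           represents (ip_sum ip) (dom_sum D) (hform a b) H' ->
           same_operator H H') &
        (alpha != 0 \/ beta != 0 ->
           bounded_inverse_norm_le (ip_sum ip) H
             (1 / Num.sqrt (alpha ^+ 2 + beta ^+ 2)))].
Proof.
move=> hip hD dD ha sa pa hb sb pb al0 be0 hal hbe tc.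
have [hi ic] := hip; have hW := inner_product_sum hi.
have hE := subspace_sum hD; have hh := hform_sesq ha hb; have sh := hform_sym sa sb.
have Esep x : (forall y, dom_sum D y -> ip_sum ip x y = 0) -> x = 0.
  move=> xE; have hT : subspace (fun _ : V => True) by [].
  have hs := inner_sesq hi (fun=> True); have D0 := hD.1.
  apply: injective_projections; apply: (orthogonal_of_dense hi dD) => y Dy.
    by have := xE (y, 0) (conj Dy D0); rewrite /ip_sum /= (sesq0r hT hs) // addr0.
  by have := xE (0, y) (conj D0 Dy); rewrite /ip_sum /= (sesq0r hT hs) // add0r.
have lowf f c x : 0 <= c -> lower_bound_on ip D f c -> dom_sum D x ->
    c * qf (ip_sum ip) x <= qf (ip_sum f) x.
  move=> c0 hf [D1 D2]; have lowz z : D z -> c * qf ip z <= qf f z.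
    move=> /hf; rewrite lecE /= /hnorm => /andP[_].
    by rewrite sqr_sqrtr // (inner_ge0 hi).
  by rewrite !qf_sum mulrDr lerD ?lowz.
have qg x : qf (ip_sum (fun x y => ip x y + (a x y + b x y))) x =
    qf (ip_sum ip) x + (qf (ip_sum a) x + qf (ip_sum b) x).
  by rewrite !qf_sum !qf_add; ring.
have solv := shifted_solvable hip hD ha sa pa hb sb pb tc.
have icW : complete (ip_sum ip).
  move=> u uC.
  have hT : subspace (fun _ : V => True) by [].
  have [//|e e0|x [_ ux]] := complete_sum hT (inner_psd hi _) (complete_inner hi ic) (u := u).
    have [|N hN] := uC (Num.sqrt e); first by rewrite sqrtr_gt0.
    exists N => m n Nm Nn; have := hN m n Nm Nn.
    by rewrite (hnorm_lt hW) ?sqrtr_gt0 // sqr_sqrtr // ltW.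
  exists x => e e0; have [|N hN] := ux (e ^+ 2); first exact: exprn_gt0.
  by exists N => n Nn; rewrite (hnorm_lt hW) // hN.
have Hrep := form_operatorP (ip := ip_sum ip) (E := dom_sum D) (h := hform a b).
exists (form_operator (ip := ip_sum ip) (E := dom_sum D) (h := hform a b)); split.
- apply: form_operator_selfadjoint => // mu mu1 f.
  (* For [mu ^+ 2 = 1] the right-hand side is exactly the squared form norm, so the constant is
     1. *)
  apply: (solv mu 1) => // x Ex; rewrite qg mu1 !mul1r addrC //.
- exact: form_operator_represents.
- by move=> H' sH' rH'; apply: form_operator_unique.
move=> nz; have s20 : 0 < alpha ^+ 2 + beta ^+ 2.
  rewrite lt_def addr_ge0 ?sqr_ge0 // andbT paddr_eq0 ?sqr_ge0 //.
  by rewrite !sqrf_eq0 negb_and; apply/orP.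
apply: form_operator_bounded_inverse => //; first by rewrite sqrtr_gt0.
  move=> f; have ab0 : 0 < alpha + beta.
    rewrite lt_def addr_ge0 // andbT; apply/eqP => ab.
    have a0 : alpha = 0 by lra.
    have b0 : beta = 0 by lra.
    by move: nz; rewrite a0 b0 eqxx; case.
  (* Without a shift, [t = a + b] must control the form norm: [t] is at least
     [(alpha + beta) |x|^2], so [|x|^2 + t] is at most [(1 + (alpha + beta)) / (alpha + beta)] times
     [t]. *)
  have [||x [Ex hx]] := solv 0 ((alpha + beta) / (1 + (alpha + beta))) _ _ f.
  - by rewrite divr_gt0 //; lra.
  - move=> x Ex; rewrite qg expr0n mul0r addr0 mulrAC ler_pdivrMr; last lra.
    have := lowf _ _ _ al0 hal Ex; have := lowf _ _ _ be0 hbe Ex.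
    by move: (qf _ x) (qf _ x) (qf _ x) => p q r; lra.
  exists x; split=> // y Ey; rewrite -hx // (_ : Complex 0 0 = 0) // mul0r addr0 //.
move=> x Tx; have [Ex _] := Tx; set y := op_app _ x.
have hT : subspace (fun _ : V * V => True) by [].
have x0 := inner_ge0 hW x; have y0 := inner_ge0 hW y.
suff : (alpha ^+ 2 + beta ^+ 2) * qf (ip_sum ip) x <= qf (ip_sum ip) y.
  by move=> le; rewrite /hnorm -sqrtrM ?(ltW s20) // ler_wsqrtr.
(* Put [s = alpha ^+ 2 + beta ^+ 2] and [r = Re (h x (twist alpha beta x))]. The lower bounds give
   [s |x|^2 <= r], and Cauchy-Schwarz with [qf_twist] gives [r^2 <= |y|^2 s |x|^2]; it remains to
   divide by [s |x|^2]. *)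
have Et := dom_twist hD alpha beta Ex.
have := Re_hform_twist hD ha sa hb sb alpha beta Ex; rewrite Hrep // -/y => hre.
have := cauchy_schwarz hT (inner_sesq hW _) (inner_sym hW _) (inner_psd hW _) (x := y)
  (y := twist alpha beta x) I I.
rewrite (qf_twist hD alpha beta (inner_sesq hi D) (inner_sym hi D) Ex) hre.
have := ler_wpM2l al0 (lowf _ _ _ al0 hal Ex).
have := ler_wpM2l be0 (lowf _ _ _ be0 hbe Ex).
rewrite !mulrA -!expr2 => be_le al_le; have := lerD al_le be_le; rewrite -mulrDl.
move: (alpha ^+ 2 + beta ^+ 2) (alpha * _ + _) s20 => s r s0 sp rq.
move: x0; rewrite le_eqVlt => /orP[/eqP <- //|x0]; first by rewrite mulr0.
have sx0 : 0 < s * qf (ip_sum ip) x by rewrite mulr_gt0.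
rewrite -(ler_pM2r sx0) -expr2 [leRHS]mulrA; apply: le_trans rq.
by rewrite ler_pXn2r ?nnegrE ?(ltW sx0) // (le_trans (ltW sx0)).
Qed.
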